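(* Let $q\geq 3$ and $k\geq 2$ be integers, and $I$ an instance of $\mathsf{k\,CSP\!-\!q}$ with strong chromatic number $\nu\geq k$. Let $p^\kappa$ ($p$ prime, $\kappa\geq 1$) be the smallest prime power such that $p^\kappa\geq q$ (thus $p^\kappa=q$ if $q$ is a prime power and $p^\kappa\leq 2(q-1)$ otherwise). Then the average differential ratio on $I$ is bounded below by $$\frac{1}{p^\kappa}\times\frac{1}{p^{\kappa\lceil\log_{p^\kappa}\nu\rceil(k-\lceil\log_{p^\kappa}k\rceil)}}\ \geq\ \frac{1}{p^\kappa}\times\frac{1}{(p^\kappa\nu)^{k-\lceil\log_{p^\kappa}k\rceil}}.$$
   Context: Let $\Sigma_q=\{0,1,\ldots,q-1\}$ and $[n]=\{1,\ldots,n\}$. An instance $I$ of $\mathsf{k\,CSP\!-\!q}$ consists of integers $n,m\ge 1$, a goal (maximize or minimize) and, for each $i\in[m]$, a weight $w_i>0$, an integer $1\le k_i\leq \min\{k,n\}$, a strictly increasing sequence $J_i=(i_1,\ldots,i_{k_i})$ of indices of $[n]$, and a function $P_i:\Sigma_q^{k_i}\to\mathbb{R}$. Solutions are vectors $x\in\Sigma_q^n$, with value $v(I,x)=\sum_{i=1}^m w_iP_i(x_{i_1},\ldots,x_{i_{k_i}})$. $\mathrm{opt}(I)$ and $\mathrm{wor}(I)$ are the best and worst solution values (maximum and minimum of $v(I,\cdot)$ if maximizing, minimum and maximum if minimizing). The average differential ratio on $I$ is $(\mathbb{E}_X[v(I,X)]-\mathrm{wor}(I))/(\mathrm{opt}(I)-\mathrm{wor}(I))$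 with $X$ uniform on $\Sigma_q^n$ (considered when $\mathrm{opt}(I)\neq\mathrm{wor}(I)$). The strong chromatic number of $I$ is the smallest $\nu$ such that there is a partition of $[n]$ into $\nu$ sets such that each $J_i$ contains at most one index from each set. *)

(* Defs.v *)
From HB Require Import structures.
From mathcomp Require Import all_boot all_order all_algebra.

Set Implicit Arguments.
Unset Strict Implicit.
Unset Printing Implicit Defensive.

Import Order.TTheory GRing.Theory Num.Theory.
Local Open Scope ring_scope.

Inductive csp_goal := Maximize | Minimize.

(* 'I_q is the alphabet {0, ..., q-1}; the variables and the constraints are  *)
(* indexed from 0. The scope J_i is given as a strictly increasing map.       *)
Record csp (R : realFieldType) (k q : nat) := CSP {
  nvars : nat;
  nctrs : nat;
  nvars_gt0 : (0 < nvars)%N;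
  nctrs_gt0 : (0 < nctrs)%N;
  goal : csp_goal;
  weight : 'I_nctrs -> R;
  weight_gt0 : forall i, 0 < weight i;
  arity : 'I_nctrs -> nat;
  arity_bounds : forall i, (1 <= arity i <= minn k nvars)%N;
  scope : forall i, 'I_(arity i) -> 'I_nvars;
  scope_incr : forall i (s t : 'I_(arity i)),
    (s < t)%N -> (scope s < scope t)%N;
  payoff : forall i, {ffun 'I_(arity i) -> 'I_q} -> R
}.

Section FiniteExtrema.
Variables (R : realFieldType) (T : finType).
Implicit Type f : T -> R.

(* The base point is a value of f as soon as T is inhabited. *)
Definition fmax f : R := \big[Num.max/head 0 (codom f)]_(x : T) f x.
Definition fmin f : R := \big[Num.min/head 0 (codom f)]_(x : T) f x.

Lemma head_codom f (x0 : T) : exists x, head 0 (codom f) = f x.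
Proof.
rewrite codomE; case E: (enum T) => [|y s]; last by exists y.
by have := mem_enum T x0; rewrite E.
Qed.

Lemma fmaxP f (x0 : T) :
  (exists x, fmax f = f x) /\ (forall x, f x <= fmax f).
Proof.
split; last by move=> x; rewrite /fmax (bigD1 x) //= le_max lexx.
rewrite /fmax; elim/big_ind: _ => [|a b [x ->] [y ->]|x _].
- exact: head_codom x0.
- by case: (leP (f x) (f y)) => _; [exists y | exists x].
- by exists x.
Qed.

Lemma fminP f (x0 : T) :
  (exists x, fmin f = f x) /\ (forall x, fmin f <= f x).
Proof.
split; last by move=> x; rewrite /fmin (bigD1 x) //= ge_min lexx.
rewrite /fmin; elim/big_ind: _ => [|a b [x ->] [y ->]|x _].
- exact: head_codom x0.
- by case: (leP (f x) (f y)) => _; [exists x | exists y].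
- by exists x.
Qed.

End FiniteExtrema.

Section Instance.
Variables (R : realFieldType) (k q : nat) (I : csp R k q).

Definition solution := {ffun 'I_(nvars I) -> 'I_q}.

Definition value (x : solution) : R :=
  \sum_(i < nctrs I) weight i * payoff [ffun s : 'I_(arity i) => x (scope s)].

Definition opt : R :=
  match goal I with Maximize => fmax value | Minimize => fmin value end.

Definition wor : R :=
  match goal I with Maximize => fmin value | Minimize => fmax value end.

Definition mean_value : R := (\sum_(x : solution) value x) / #|{: solution}|%:R.

Definition avg_diff_ratio : R := (mean_value - wor) / (opt - wor).

Definition strong_coloring (P : {set {set 'I_(nvars I)}}) : bool :=
  partition P [set: 'I_(nvars I)] &&
  [forall i : 'I_(nctrs I), forall A in P,
     #|[set scope s | s : 'I_(arity i)] :&: A| <= 1]%N.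

Definition strongly_colorable (nu : nat) : bool :=
  [exists P : {set {set 'I_(nvars I)}}, strong_coloring P && (#|P| == nu)].

Lemma strongly_colorable_ex : exists nu, strongly_colorable nu.
Proof.
pose P := preim_partition (@id 'I_(nvars I)) [set: 'I_(nvars I)].
exists #|P|; apply/existsP; exists P; rewrite eqxx andbT.
rewrite /strong_coloring preim_partitionP /=.
apply/forallP=> i; apply/forall_inP=> A /imsetP[x _ ->].
rewrite (leq_trans (subset_leq_card (subsetIr _ _))) //.
by apply/card_le1_eqP=> y z; rewrite !inE /= => /eqP<- /eqP<-.
Qed.

Definition strong_chromatic_number : nat := ex_minn strongly_colorable_ex.

End Instance.

Definition prime_power (m : nat) : Prop :=
  exists p e : nat, [/\ prime p, (1 <= e)%N & m = (p ^ e)%N].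

(* Main.v *)
Require Import Defs.
From mathcomp Require Import all_boot all_order all_algebra.
From mathcomp Require Import all_fingroup all_solvable all_field.

Set Implicit Arguments.
Unset Strict Implicit.
Unset Printing Implicit Defensive.

Import Order.TTheory GRing.Theory Num.Theory.
Local Open Scope ring_scope.

(** The lower bound is a derandomization of the uniform solution by a small
orthogonal array containing an optimal solution.

Suppose that some probability distribution [mu] on solutions induces, on the
scope of every constraint, the uniform distribution. Then the [mu]-expectation
of the value is the mean value, so the average differential ratio is the
[mu]-expectation of [(value y - wor I) / (opt I - wor I)]. This quantity is
nonnegative and equals 1 at an optimal solution [x], hence the ratio is at least
[mu x] ([orthogonal_array_ratio]).

To get such a [mu] with [mu x] large, color the variables so that every scope
is rainbow, and index the colors by columns of an orthogonal array of strength
[k] over an alphabet [F] of [P >= q] symbols. A uniformly random row gives every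
variable a symbol of [F] (the one in the column of its color), and these symbols
are independent and uniform along each scope. They have to be turned into
letters of [Σ_q], although [q] need not divide [P], and one row [w0] has to
give [x]. Both are achieved by sending each symbol through a random channel
[planted], independently for all variables: it outputs [x j] when the symbol
agrees with the row [w0], and otherwise follows the one law which makes the
letter uniform when the symbol is. The row [w0] alone gives [x] a mass of at
least one over the number of rows.

It remains to find an array with few rows. Take [P = p ^ kappa],
[F] the field with [P] elements, [m = up_log P nu], and let the columns be
indexed by the extension [L] of degree [m] of [F], which has [P ^ m >= nu]
elements. The rows are the words of the dual of an extended BCH code: the column
[α] of its generating matrix consists of [1] and of the coordinates over [F] of
the powers [α ^ i], where [0 < i < k] and [i] is not of the form
[P ^ j] with [j > 0]. A relation with coefficients in [F] between the [α ^ i]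
remains true for [α ^ (i * P)] by Frobenius, so the omitted powers come for
free, and Vandermonde shows that any [k] columns are independent ([bch_free]);
equivalently the array has strength [k] ([linear_orthogonal_array]). There are
[k - up_log P k] powers left ([size_bch_exponents]), each contributing [m]
coordinates, whence [P ^ (1 + m * (k - up_log P k))] rows.

The other claims are elementary: some power of 2 lies between [q] and
[2 * (q - 1)], and [P ^ up_log P nu <= P * nu]. *)

(** * Product measures and orthogonal arrays *)

(** Coordinates outside the range of [g] integrate to 1: a product measure has
product marginals. *)
Lemma sum_prod_marginal (R : comNzRingType) (A B J : finType) (w : A -> B -> R)
    (g : J -> A) (f : {ffun J -> B} -> R) :
    injective g -> (forall x, \sum_b w x b = 1) ->
  \sum_(y : {ffun A -> B}) (\prod_x w x (y x)) * f [ffun s => y (g s)]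
  = \sum_(z : {ffun J -> B}) (\prod_s w (g s) (z s)) * f z.
Proof.
move=> g_inj w1.
rewrite (partition_big (fun y : {ffun A -> B} => [ffun s => y (g s)]) xpredT) //=.
apply: eq_bigr => z _.
(* The fiber of [z] is a box: [Q x] is the set of letters allowed at [x]. *)
pose Q x := [pred b | [forall s, (g s == x) ==> (b == z s)]].
rewrite (eq_bigr (fun y : {ffun A -> B} => (\prod_x w x (y x)) * f z));
  last by move=> y /eqP->.
rewrite -mulr_suml; congr (_ * _).
rewrite (eq_bigl (mem (family Q))); last first.
  move=> y; apply/eqP/familyP => [yz x | Qy].
    by apply/forallP=> s; apply/implyP=> /eqP <-; rewrite -yz ffunE.
  apply/ffunP=> s; rewrite ffunE; have/forallP/(_ s) := Qy (g s).
  by rewrite eqxx => /eqP.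
rewrite -(bigA_distr_big_dep _ (fun x b => w x b)).
rewrite (bigID (mem [set g s | s in J])) /= mulrC big1 ?mul1r; last first.
  move=> x xNg; rewrite -[RHS](w1 x); apply: eq_bigl => b.
  by apply/forallP=> s; apply/implyP=> /eqP gs; rewrite -gs imset_f in xNg.
rewrite big_imset /=; last by move=> s t _ _; apply: g_inj.
apply: eq_bigr => s _; rewrite -[RHS](big_pred1_eq +%R); apply: eq_bigl => b.
apply/forallP/eqP => [/(_ s) | -> t]; first by rewrite eqxx => /eqP.
by apply/implyP=> /eqP /g_inj->.
Qed.

(** Rows are indexed by [M] and columns by [T]; the frequency of a pattern is
stated without division. *)
Definition orthogonal_array (F T M : finType) (k : nat) (u : M -> T -> F) :=
  forall (a : nat) (g : 'I_a -> T), (a <= k)%N -> injective g ->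
  forall t : {ffun 'I_a -> F},
    (#|[set w | [ffun s => u w (g s)] == t]| * #|F| ^ a)%N = #|M|.

Section Marginals.
Variables (R : realFieldType) (q k : nat).

Lemma sum_orthogonal_array (F T M : finType) (u : M -> T -> F) a
    (g : 'I_a -> T) (Phi : {ffun 'I_a -> F} -> R) :
    orthogonal_array k u -> (a <= k)%N -> injective g ->
  #|F|%:R ^+ a * (\sum_w Phi [ffun s => u w (g s)])
  = #|M|%:R * \sum_t Phi t.
Proof.
move=> uOA ak g_inj.
rewrite (partition_big (fun w => [ffun s => u w (g s)]) xpredT) //= !mulr_sumr.
apply: eq_bigr => t _; rewrite (eq_bigr (fun=> Phi t)); last by move=> w /eqP->.
rewrite sumr_const -(uOA a g ak g_inj t) natrM natrX.
by rewrite -(mulr_natl (Phi t)) mulrA [X in _ = X * _]mulrC cardsE.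
Qed.

(** Stated on functions of a single scope, which is how the value of a solution
decomposes; together with [array_marginal] it shows that the uniform
distribution and the one built on an array have the same expected value. *)
Lemma mean_marginal n a (J : 'I_a -> 'I_n) (f : {ffun 'I_a -> 'I_q} -> R) :
    (0 < q)%N -> injective J ->
  (\sum_(y : {ffun 'I_n -> 'I_q}) f [ffun s => y (J s)])
    / #|{: {ffun 'I_n -> 'I_q}}|%:R = (\sum_z f z) / q%:R ^+ a.
Proof.
move=> q0 J_inj.
have q_neq0 : q%:R != 0 :> R by rewrite pnatr_eq0 -lt0n.
have := @sum_prod_marginal R _ 'I_q _ (fun _ _ => q%:R^-1) _ f J_inj.
rewrite sumr_const card_ord -(mulr_natl (q%:R^-1)) mulfV // => /(_ (fun=> erefl)).
rewrite -!mulr_sumr !prodr_const !card_ord card_ffun !card_ord natrX !exprVn.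
by rewrite ![_^-1 * _]mulrC.
Qed.

(** [W j] is a channel turning the symbol seen by variable [j] into a letter, and
turning a uniform symbol into a uniform letter. Since the columns met by a scope
are distinct, the symbols along it are jointly uniform, so the letters produced
by independent channels are too. *)
Lemma array_marginal (F T M : finType) (u : M -> T -> F) n (c : 'I_n -> T)
    (W : 'I_n -> F -> 'I_q -> R) a (J : 'I_a -> 'I_n)
    (f : {ffun 'I_a -> 'I_q} -> R) :
    (0 < q)%N -> (0 < #|F|)%N -> (0 < #|M|)%N ->
    orthogonal_array k u -> (a <= k)%N -> injective (c \o J) ->
    (forall j x, \sum_b W j x b = 1) ->
    (forall j b, \sum_x W j x b = #|F|%:R / q%:R) ->
  \sum_(y : {ffun 'I_n -> 'I_q})
     (#|M|%:R^-1 * \sum_w \prod_j W j (u w (c j)) (y j)) * f [ffun s => y (J s)]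
  = (\sum_z f z) / q%:R ^+ a.
Proof.
move=> q0 F0 M0 uOA ak cJ_inj W1 WF.
have q_neq0 : q%:R != 0 :> R by rewrite pnatr_eq0 -lt0n.
have F_neq0 : #|F|%:R != 0 :> R by rewrite pnatr_eq0 -lt0n.
have M_neq0 : #|M|%:R != 0 :> R by rewrite pnatr_eq0 -lt0n.
have J_inj : injective J by move=> s t /(congr1 c) /cJ_inj.
under eq_bigr => y _ do rewrite -mulrA mulr_suml.
rewrite -mulr_sumr exchange_big /=.
under eq_bigr => w _ do
  rewrite (@sum_prod_marginal R _ _ _ (fun j => W j (u w (c j))) J f) //.
rewrite exchange_big /= mulr_sumr mulr_suml; apply: eq_bigr => z _.
rewrite -mulr_suml mulrA mulrC; congr (_ * _).
pose Phi (t : {ffun 'I_a -> F}) := \prod_s W (J s) (t s) (z s).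
transitivity (#|M|%:R^-1 * \sum_w Phi [ffun s => u w ((c \o J) s)]).
  congr (_ * _); apply: eq_bigr => w _.
  by apply: eq_bigr => s _; rewrite ffunE.
apply: (mulfI (expf_neq0 a F_neq0)).
rewrite mulrCA sum_orthogonal_array // mulKf //.
rewrite -(bigA_distr_bigA (fun s x => W (J s) x (z s))) /=.
under eq_bigr do rewrite WF.
by rewrite prodr_const card_ord exprMn exprVn.
Qed.

End Marginals.

(** * From an orthogonal array to the differential ratio *)

Section PlantedChannel.
Variables (R : realFieldType) (q : nat) (F : finType).
Hypothesis q_bounds : (1 < q <= #|F|)%N.

(** Symbol [a0] is sent to [x] for sure. Every other symbol has the same output
law, which is then forced by [sum_planted_symbol]. *)
Definition planted (x : 'I_q) (a0 a : F) (b : 'I_q) : R :=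
  let d := (b == x)%:R in
  if a == a0 then d else (#|F|%:R / q%:R - d) / (#|F|%:R - 1).

Let q_neq0 : q%:R != 0 :> R.
Proof. by case/andP: q_bounds => /ltnW; rewrite pnatr_eq0 -lt0n. Qed.

Let F_gt1 : (1 < #|F|)%N.
Proof. by case/andP: q_bounds; apply: leq_trans. Qed.

Let F_neq1 : #|F|%:R - 1 != 0 :> R.
Proof. by rewrite subr_eq0 (eqr_nat R _ 1) gtn_eqF. Qed.

Lemma planted_ge0 x a0 a b : 0 <= planted x a0 a b.
Proof.
rewrite /planted; case: eqP => _ //.
apply: divr_ge0; rewrite subr_ge0 ?ler1n ?(ltnW F_gt1) //.
(* The indicator is at most 1, and [1 <= #|F| / q]. *)
apply: (@le_trans _ _ 1); first by case: eqP.
have /andP[q1 qF] := q_bounds.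
by rewrite ler_pdivlMr ?ltr0n ?(ltnW q1) // mul1r ler_nat.
Qed.

Lemma sum_planted_letter x a0 a : \sum_b planted x a0 a b = 1.
Proof.
have sum_d : \sum_b (b == x)%:R = 1 :> R.
  by rewrite (bigD1 x) //= eqxx big1 ?addr0 // => b /negPf->.
rewrite /planted; case: eqP => _ //.
rewrite -mulr_suml sumrB sum_d sumr_const card_ord -(mulr_natl (_ / _)).
by rewrite [q%:R * _]mulrC mulfVK // mulfV.
Qed.

Lemma sum_planted_symbol x a0 b : \sum_a planted x a0 a b = #|F|%:R / q%:R.
Proof.
rewrite (bigD1 a0) //= {1}/planted eqxx.
rewrite (eq_bigr (fun=> (#|F|%:R / q%:R - (b == x)%:R) / (#|F|%:R - 1))).
  rewrite sumr_const cardC1 -subn1 -(mulr_natl (_ / _)) natrB ?(ltnW F_gt1) //.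
  by rewrite mulrC mulfVK // addrC subrK.
by move=> a /negPf; rewrite /planted => ->.
Qed.

End PlantedChannel.

Section Ratio.
Variables (R : realFieldType) (q k : nat).

Lemma normalized_value_ge0 (I : csp R k q) (y : solution I) : opt I <> wor I ->
  0 <= (value y - wor I) / (opt I - wor I).
Proof.
have [_ hmax] := fmaxP (@value R k q I) y.
have [_ hmin] := fminP (@value R k q I) y.
rewrite /opt /wor; case: (goal I) => _.
  by apply: divr_ge0; rewrite subr_ge0 // (le_trans (hmin y)).
by rewrite -mulrNN -invrN !opprB; apply: divr_ge0;
  rewrite subr_ge0 // (le_trans (hmin y)).
Qed.

Lemma opt_attained (I : csp R k q) : (0 < q)%N ->
  exists x : solution I, value x = opt I.
Proof.
move=> q0; pose x0 : solution I := [ffun=> Ordinal q0].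
have [[x hx] _] := fmaxP (@value R k q I) x0.
have [[y hy] _] := fminP (@value R k q I) x0.
by rewrite /opt; case: (goal I); [exists x | exists y].
Qed.

(** The distribution [mu] obtained by passing a random row through the planted
channels has uniform marginals on scopes and gives an optimal solution a mass of
at least [#|M|%:R^-1]; the ratio is a [mu]-average of nonnegative numbers, the
one at the optimal solution being 1. *)
Lemma orthogonal_array_ratio (I : csp R k q) (F T M : finType) (u : M -> T -> F)
    (c : 'I_(nvars I) -> T) :
    (1 < q <= #|F|)%N -> (0 < #|M|)%N -> opt I <> wor I ->
    orthogonal_array k u ->
    (forall i : 'I_(nctrs I), injective (c \o @scope _ _ _ I i)) ->
  #|M|%:R^-1 <= avg_diff_ratio I.
Proof.
move=> /andP[q1 qF] M0 optNwor uOA c_inj.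
have q0 := ltnW q1; have F0 := leq_trans q0 qF.
have [x xopt] := opt_attained I q0.
have /card_gt0P[w0 _] := M0.
pose W (j : 'I_(nvars I)) (a : F) (b : 'I_q) : R :=
  planted R (x j) (u w0 (c j)) a b.
have q_bounds : (1 < q <= #|F|)%N by rewrite q1.
have W1 j a : \sum_b W j a b = 1 by apply: sum_planted_letter.
have WF j b : \sum_a W j a b = #|F|%:R / q%:R by apply: sum_planted_symbol.
have W0 j a b : 0 <= W j a b by apply: planted_ge0.
pose mu (y : solution I) := #|M|%:R^-1 * \sum_w \prod_j W j (u w (c j)) (y j).
have mu0 y : 0 <= mu y.
  by rewrite mulr_ge0 ?invr_ge0 // sumr_ge0 // => w _; apply: prodr_ge0.
(* Row [w0] alone already contributes this mass. *)
have mux : #|M|%:R^-1 <= mu x.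
  rewrite ler_peMr ?invr_ge0 // (bigD1 w0) //= big1 ?lerDl.
    by apply: sumr_ge0 => w _; apply: prodr_ge0.
  by move=> j _; rewrite /W /planted !eqxx.
have mu1 : \sum_y mu y = 1.
  rewrite -mulr_sumr exchange_big /=.
  under eq_bigr => w _ do rewrite -(bigA_distr_bigA (fun j => W j (u w (c j)))).
  rewrite (eq_bigr (fun=> 1)); last by move=> w _; rewrite big1.
  by rewrite sumr_const mulVf // pnatr_eq0 -lt0n.
have mu_mean : mean_value I = \sum_y mu y * value y.
  rewrite /mean_value /value exchange_big mulr_suml /=.
  under [RHS]eq_bigr do rewrite mulr_sumr.
  rewrite exchange_big /=; apply: eq_bigr => i _.
  have [_ aik] := andP (arity_bounds i).
  have {}aik : (arity i <= k)%N := leq_trans aik (geq_minl _ _).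
  pose f := @payoff R k q I i.
  under [RHS]eq_bigr do rewrite mulrCA.
  rewrite -!mulr_sumr -mulrA; congr (_ * _).
  have scope_inj : injective (@scope _ _ _ I i) by move=> s t /(congr1 c) /c_inj.
  by rewrite (mean_marginal f q0 scope_inj)
    (array_marginal f q0 F0 M0 uOA aik (@c_inj i) W1 WF).
rewrite (_ : avg_diff_ratio I
           = \sum_y mu y * ((value y - wor I) / (opt I - wor I))); last first.
  rewrite /avg_diff_ratio mu_mean -[wor I in LHS]mul1r -{1}mu1 mulr_suml.
  rewrite mul1r -sumrB mulr_suml; apply: eq_bigr => y _.
  by rewrite -mulrBr mulrA.
rewrite (bigD1 x) //= xopt divff ?subr_eq0 ?mulr1; last exact/eqP.
rewrite (le_trans mux) // lerDl; apply: sumr_ge0 => y _.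
by rewrite mulr_ge0 // normalized_value_ge0.
Qed.

End Ratio.

(** * Extensions of a finite field *)


(** [L] is the splitting field of [X ^ n - X] with [n = #|F| ^ m]. The roots are
distinct as the derivative is -1, and they are the fixed points of the [m]-th
power of the Frobenius automorphism, so they form a field: all of [L] consists
of roots, and [L] has [n] elements. *)
Lemma finField_ext_exists (F : finFieldType) (m : nat) : (0 < m)%N ->
  exists L : fieldExtType F, \dim {:L} = m.
Proof.
move=> m0; set n := (#|F| ^ m)%N.
have n1 : (1 < n)%N by rewrite -(exp1n m) ltn_exp2r ?finNzRing_gt1.
pose f (K : nzRingType) : {poly K} := 'X^n - 'X.
have sz_f K : size (f K) = n.+1.
  by rewrite size_polyDl size_polyXn // size_polyN size_polyX.
have /FinSplittingFieldFor[/= L [zs Dzs genL]] : f F != 0.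
  by rewrite -size_poly_eq0 sz_f.
rewrite rmorphB rmorphXn /= map_polyX -/(f L) in Dzs.
exists L.
have nL0 : n%:R = 0 :> L.
  rewrite /n natrX -(rmorph_nat (in_alg L)).
  have -> : #|F|%:R = 0 :> F.
    have := expg_cardG (in_setT (1 : F) : 1 \in [group of [set: F]]).
    by rewrite FinRing.zmodXgE cardsT.
  by rewrite rmorph0 expr0n gtn_eqF.
have Uzs : uniq zs.
  rewrite -separable_prod_XsubC -(eqp_separable Dzs) unlock.
  rewrite derivB derivXn derivX -(mulr_natl _ n) -polyC_natr nL0 mul0r sub0r.
  by rewrite -scaleN1r coprimepZr ?oppr_eq0 ?oner_eq0 // coprimep1.
have size_zs : size zs = n.
  by apply: succn_inj; rewrite -(size_prod_XsubC _ id) -(eqp_size Dzs) sz_f.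
have mem_zs z : (z \in zs) = (z ^+ n == z).
  by rewrite -root_prod_XsubC -(eqp_root Dzs) rootE !hornerE subr_eq0.
have [a _ Da] := finField_galois_generator (sub1v {:L}).
have Dam z : (a ^+ m)%g z = z ^+ n.
  rewrite /n; elim: (m) z => [|i IHi] z; first by rewrite gal_id.
  by rewrite expgSr expnSr exprM galM ?memvf // IHi Da ?memvf // dimv1 expn1.
have all_zs z : z \in zs.
  have : z \in <<1 & zs>>%VS by rewrite genL memvf.
  have /subvP/(_ z) sub : (<<1 & zs>> <= fixedSpace (a ^+ m)%g)%VS.
    rewrite -[fixedSpace _]subfield_closed agenvS // subv_add sub1v.
    apply/span_subvP=> y; rewrite mem_zs => /eqP yn.
    by apply/fixedSpaceP; rewrite Dam.
  by move/sub/fixedSpaceP; rewrite Dam mem_zs => ->.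
pose finL := FinFieldExtType L.
have cardL : #|finL| = n.
  rewrite -size_zs -(card_uniqP (Uzs : uniq (zs : seq finL))).
  by apply: eq_card => z; rewrite [RHS]all_zs.
have cardV := card_vspacef (Vector.class (finvect_type L)).
rewrite card_vspace in cardV.
have /eqP : (#|F| ^ \dim {:L} = #|F| ^ m)%N by rewrite -/n -cardL -cardV.
by rewrite eqn_exp2l ?finNzRing_gt1 // => /eqP.
Qed.

(** * Independence of the columns of a BCH parity-check matrix *)

Section BCH.
Variable F : finFieldType.
Variable L : fieldExtType F.
Local Notation P := #|F|.

(** The coefficients are fixed by the Frobenius map, being in [F]; this is what
carries a relation between powers [α ^ i] over to the powers [α ^ (i * #|F|)]. *)
Lemma frobenius_sum a (c : 'I_a -> F) (x : 'I_a -> L) :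
  (\sum_s c s *: x s) ^+ P = \sum_s c s *: x s ^+ P.
Proof.
have [p pr_p pF] := finPcharP F.
have pL : p \in [pchar L] by rewrite pchar_lalg.
have P_nat : [pchar L].-nat P.
  rewrite (eq_pnat _ (pcharf_eq pL)) -[#|F|]/#|pPrimeCharType pF|.
  by rewrite card_pprimeChar pnatX pnat_id.
rewrite (big_morph (fun y => y ^+ P)
  (fun y z => exprDn_pchar y z P_nat) (_ : _ = 0)).
  by apply: eq_bigr => s _; rewrite exprZn expf_card.
by rewrite expr0n gtn_eqF // ltnW ?finNzRing_gt1.
Qed.

(** The hypothesis extends to all polynomials of size at most [a]; apply it to the
one vanishing at every [alpha s] but one. *)
Lemma vandermonde_free a (c : 'I_a -> F) (alpha : 'I_a -> L) :
    injective alpha -> (forall i, (i < a)%N -> \sum_s c s *: alpha s ^+ i = 0) ->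
  forall s, c s = 0.
Proof.
move=> alpha_inj c0 s0.
have poly0 (p : {poly L}) : (size p <= a)%N -> \sum_s c s *: p.[alpha s] = 0.
  move=> sz_p.
  under eq_bigr => s _ do rewrite (horner_coef_wide _ sz_p) scaler_sumr.
  rewrite exchange_big big1 //= => i _.
  under eq_bigr => s _ do rewrite scalerAr.
  by rewrite -mulr_sumr c0 ?mulr0.
pose p := \prod_(s | s != s0) ('X - (alpha s)%:P).
have sz_p : (size p <= a)%N.
  rewrite /p -big_enum size_prod_XsubC -cardE cardC1 card_ord.
  by rewrite prednK // (leq_ltn_trans _ (ltn_ord s0)).
move: (poly0 p sz_p); rewrite (bigD1 s0) //= big1 ?addr0 => [/eqP|s s_s0].
  rewrite scaler_eq0 => /orP[/eqP //|].
  rewrite horner_prod prodf_seq_eq0 => /hasP[s _ /andP[s_s0]].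
  rewrite !hornerE subr_eq0 => /eqP /alpha_inj /esym /eqP.
  by rewrite (negPf s_s0).
by rewrite /p horner_prod (bigD1 s) //= !hornerE subrr mul0r scaler0.
Qed.

(** The bound on [j] makes the excluded list exactly the powers of [P], other
than 1, that are less than [k]. *)
Definition bch_exponents k :=
  [seq i <- iota 1 k.-1
     | i \notin [seq (P ^ j.+1)%N | j <- iota 0 (up_log P k).-1]].

Lemma size_bch_exponents k : (1 < k)%N ->
  size (bch_exponents k) = (k - up_log P k)%N.
Proof.
move=> k1; have P1 := finNzRing_gt1 F.
set pw := [seq (P ^ j.+1)%N | j <- iota 0 (up_log P k).-1].
have ul0 : (0 < up_log P k)%N by rewrite up_log_gt0 P1.
have uniq_pw : uniq pw.
  rewrite map_inj_in_uniq ?iota_uniq // => i j _ _ /eqP.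
  by rewrite eqn_exp2l // eqSS => /eqP.
have sub_pw : {subset pw <= iota 1 k.-1}.
  move=> i /mapP[j]; rewrite mem_iota add0n /= => jlt ->{i}; rewrite mem_iota.
  rewrite expn_gt0 (ltnW P1) /= add1n prednK ?(ltnW k1) //.
  apply: leq_ltn_trans (up_log_gtn P1 k1).
  by rewrite leq_exp2l.
have := count_predC (mem pw) (iota 1 k.-1).
rewrite size_iota -size_filter.
have /perm_size -> : perm_eq [seq i <- iota 1 k.-1 | mem pw i] pw.
  apply: uniq_perm => // [|i]; first by rewrite filter_uniq ?iota_uniq.
  by rewrite mem_filter andb_idr //; apply: sub_pw.
rewrite size_map size_iota /bch_exponents size_filter -/pw => count_pw.
apply: (@addnI (up_log P k).-1); rewrite [LHS]count_pw.
have ulk : (up_log P k <= k)%N by rewrite up_log_min // ltnW // ltn_expl.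
by rewrite -[in LHS](subnKC ulk) -{1}(prednK ul0) addSn.
Qed.

(** By strong induction on [i] the relation holds for every exponent below [k]: an
excluded exponent [P ^ j.+1] is obtained from [P ^ j] by Frobenius. *)
Lemma bch_free k a (c : 'I_a -> F) (alpha : 'I_a -> L) :
    (a <= k)%N -> injective alpha -> \sum_s c s = 0 ->
    (forall i, i \in bch_exponents k -> \sum_s c s *: alpha s ^+ i = 0) ->
  forall s, c s = 0.
Proof.
move=> ak alpha_inj c0 c_exp; apply: (vandermonde_free alpha_inj) => i ia.
have {ia ak} ik : (i < k)%N := leq_trans ia ak.
elim/ltn_ind: i ik => -[|i] IHi ik.
  under eq_bigr do rewrite expr0.
  by rewrite -scaler_suml c0 scale0r.
have [|] := boolP (i.+1 \in bch_exponents k); first exact: c_exp.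
have k0 : (0 < k)%N by case: (k) ik.
rewrite mem_filter mem_iota /= add1n prednK // ik andbT negbK.
case/mapP => j _ ij.
have P1 := finNzRing_gt1 F.
have ltj : (P ^ j < i.+1)%N by rewrite ij ltn_exp2l.
have := congr1 (fun y => y ^+ P) (IHi _ ltj (ltn_trans ltj ik)).
rewrite frobenius_sum expr0n gtn_eqF ?(ltnW P1) // ij expnSr.
by apply: etrans; apply: eq_bigr => s _; rewrite exprM.
Qed.
End BCH.

(** * Linear orthogonal arrays *)

Import VectorInternalTheory.

Section LinearArray.
Variable F : finFieldType.

(** Multiplication by [H] is onto, so all its fibers are translates of each
other. *)
Lemma card_mulmx_fiber D a (H : 'M[F]_(a, D)) (t : 'cV_a) : row_free H ->
  (#|[set w : 'cV_D | H *m w == t]| * #|F| ^ a)%N = #|{: 'cV[F]_D}|.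
Proof.
move=> Hfree; pose fiber (t : 'cV_a) := [set w : 'cV_D | H *m w == t].
have fiber_eq t' : #|fiber t'| = #|fiber t|.
  have /row_freeP[B HB] := Hfree.
  have -> : fiber t' = [set w + B *m (t' - t) | w in fiber t].
    apply/setP=> w; apply/idP/imsetP => [|[v]]; rewrite !inE => /eqP Hw.
      exists (w - B *m (t' - t)); last by rewrite subrK.
      by rewrite inE mulmxBr mulmxA HB mul1mx Hw opprB addrC subrK.
    by move=> ->; rewrite mulmxDr mulmxA HB mul1mx Hw addrC subrK.
  by rewrite card_imset //; apply: addIr.
rewrite -[RHS]sum1_card (partition_big (mulmx H) xpredT) //=.
rewrite (eq_bigr (fun=> #|fiber t|)) => [|t' _].
  by rewrite sum_nat_const card_mx muln1 mulnC.
by rewrite -(fiber_eq t') sum1_card -cardsE.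
Qed.

(** The duality between codes and arrays: if any [k] columns [h x] of the
generating matrix are independent, any prescription of [k] entries is met by
equally many code words. *)
Lemma linear_orthogonal_array (T : finType) D k (h : T -> 'rV[F]_D) :
    (forall a (g : 'I_a -> T) (c : 'I_a -> F), (a <= k)%N -> injective g ->
       \sum_s c s *: h (g s) = 0 -> forall s, c s = 0) ->
  orthogonal_array k (fun (w : 'cV[F]_D) x => (h x *m w) 0 0).
Proof.
move=> h_free a g ak g_inj t.
pose H := \matrix_s h (g s).
have Hfree : row_free H.
  rewrite -kermx_eq0; apply/eqP/row_matrixP => i; rewrite row0.
  apply/rowP=> s; rewrite [RHS]mxE; set c := row i _.
  apply: (h_free a g (fun s => c 0 s)) => //.
  have : c *m H = 0 by rewrite -row_mul mulmx_ker row0.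
  rewrite mulmx_sum_row => cH0; rewrite -[RHS]cH0.
  by apply: eq_bigr => s' _; rewrite rowK.
rewrite -(card_mulmx_fiber (\col_s t s) Hfree); congr (_ * _)%N.
apply: eq_card => w; rewrite !inE; apply/eqP/eqP => [<-|Hw].
  apply/colP=> s; rewrite !mxE ffunE !mxE.
  by apply: eq_bigr => j _; rewrite !mxE.
apply/ffunP => s; rewrite ffunE; move/colP/(_ s): Hw; rewrite !mxE => <-.
by apply: eq_bigr => j _; rewrite !mxE.
Qed.

(** The columns are indexed by the extension of degree [m]. The size [1 + _ * m]
of the message counts the constant coordinate and [m] coordinates over [F] for
each exponent in [bch_exponents F k]. *)
Lemma bch_orthogonal_array k m : (1 < k)%N -> (0 < m)%N ->
  exists (T : finType) (u : 'cV[F]_(1 + (k - up_log #|F| k) * m) -> T -> F),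
    #|T| = (#|F| ^ m)%N /\ orthogonal_array k u.
Proof.
move=> k1 m0; have [L dimL] := finField_ext_exists F m0.
set r := (k - up_log #|F| k)%N.
pose e := bch_exponents F k.
have sz_e : size e = r := size_bch_exponents F k1.
pose T := finvect_type L.
have cardT : #|T| = (#|F| ^ m)%N.
  by rewrite -dimL -(card_vspacef (Vector.class T)) card_vspace.
(* Replacing [m] by [dim L] makes the types of [v2r] match without casts. *)
have dimL' : dim L = m by rewrite -dimL dimvf.
move: cardT; rewrite -dimL' => cardT.
pose h (x : T) : 'rV[F]_(1 + r * dim L) :=
  row_mx 1%:M (mxvec (\matrix_(i < r) v2r ((x : L) ^+ nth 0%N e i))).
exists T, (fun w x => (h x *m w) 0 0); split=> //.
apply: linear_orthogonal_array => a g c ak g_inj sum0.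
apply: (@bch_free F L k a c g ak g_inj).
  move/(congr1 (fun M => (lsubmx M) 0 0)): sum0.
  rewrite linear_sum summxE /= !mxE => sum0; rewrite -[RHS]sum0.
  by apply: eq_bigr => s _; rewrite linearZ /= row_mxKl !mxE eqxx mulr1.
move=> i ie; have ltir : (index i e < r)%N by rewrite -sz_e index_mem.
move/(congr1 (fun M => row (Ordinal ltir) (vec_mx (rsubmx M)))): sum0.
rewrite !linear_sum !linear0 => sum0.
apply: v2r_inj; rewrite linear_sum linear0 /=.
rewrite -[RHS]sum0; apply: eq_bigr => s _.
by rewrite !linearZ /= row_mxKr mxvecK rowK /= nth_index.
Qed.
End LinearArray.

(** * Strong colorings and arithmetic *)

(** Classes of a strong partition of minimal size are numbered, and the numbers
embedded in [T]. *)
Lemma strong_coloring_map (R : realFieldType) (k q : nat) (I : csp R k q)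
    (T : finType) : (strong_chromatic_number I <= #|T|)%N ->
  exists c : 'I_(nvars I) -> T,
    forall i : 'I_(nctrs I), injective (c \o @scope _ _ _ I i).
Proof.
rewrite /strong_chromatic_number; case: ex_minnP => nu.
case/existsP=> B /andP[/andP[Bpart /forallP Bstrong] /eqP <-] _ leBT.
have j0 : 'I_(nvars I) by exact: Ordinal (nvars_gt0 I).
have Bj j : pblock B j \in B.
  by rewrite pblock_mem // (cover_partition Bpart).
have /card_gt0P[t0 _] : (0 < #|T|)%N.
  by apply: leq_trans leBT; apply/card_gt0P; exists (pblock B j0).
pose rank j := index (pblock B j) (enum B).
have lt_rank j : (rank j < size (enum T))%N.
  rewrite -cardE; apply: leq_trans leBT.
  by rewrite cardE index_mem mem_enum.
exists (fun j => nth t0 (enum T) (rank j)) => i s t /= /eqP.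
rewrite nth_uniq ?enum_uniq // => /eqP rank_st.
have block_st : pblock B (scope s) = pblock B (scope t).
  rewrite -(nth_index set0 (_ : pblock B (scope s) \in enum B)) ?mem_enum //.
  by rewrite -/(rank _) rank_st nth_index ?mem_enum.
have mem_block j : j \in pblock B j.
  by rewrite mem_pblock (cover_partition Bpart).
have /forall_inP/(_ _ (Bj (scope s)))/card_le1_eqP one := Bstrong i.
have scope_st : scope s = scope t.
  apply: one; rewrite !inE imset_f ?mem_block //=.
  by rewrite block_st mem_block.
by apply/val_inj; case: (ltngtP s t) => // /scope_incr; rewrite scope_st ltnn.
Qed.

(** The least power of 2 that is at least [q] is less than [2 * q], and even. *)
Lemma prime_power_below_double (q : nat) : (1 < q)%N ->
  exists2 m, prime_power m & (q <= m <= 2 * (q - 1))%N.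
Proof.
move=> q1; have [lo hi] := andP (up_log_bounds (isT : (1 < 2)%N) q1).
have e0 : (0 < up_log 2 q)%N by rewrite up_log_gt0.
exists (2 ^ up_log 2 q)%N; first by exists 2, (up_log 2 q).
by rewrite hi -(prednK e0) expnS leq_pmul2l //= subn1 -ltnS (ltn_predK q1).
Qed.

Lemma up_log_pow_le (b n : nat) : (1 < b)%N -> (1 < n)%N ->
  (b ^ up_log b n <= b * n)%N.
Proof.
move=> b1 n1; rewrite -(prednK (_ : 0 < up_log b n)%N) ?up_log_gt0 ?b1 //.
by rewrite expnS leq_mul2l ltnW ?orbT // up_log_gtn.
Qed.

Theorem corollary2p6 (R : realFieldType) (q k : nat) (I : csp R k q)
    (nu p kappa : nat)
    (hq : (3 <= q)%N) (hk : (2 <= k)%N)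
    (hnu : nu = strong_chromatic_number I) (hknu : (k <= nu)%N)
    (hI : opt I <> wor I)
    (hp : prime p) (hkappa : (1 <= kappa)%N) (hqp : (q <= p ^ kappa)%N)
    (hmin : forall m : nat, prime_power m -> (q <= m)%N -> (p ^ kappa <= m)%N) :
  [/\ prime_power q -> (p ^ kappa)%N = q,
      ~ prime_power q -> (p ^ kappa <= 2 * (q - 1))%N,
      1 / (p ^ kappa)%:R
        * (1 / (p ^ (kappa * up_log (p ^ kappa) nu
                       * (k - up_log (p ^ kappa) k)))%:R)
        <= avg_diff_ratio I
    & 1 / (p ^ kappa)%:R
        * (1 / ((p ^ kappa * nu) ^ (k - up_log (p ^ kappa) k))%:R)
        <= 1 / (p ^ kappa)%:R
             * (1 / (p ^ (kappa * up_log (p ^ kappa) nu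
                            * (k - up_log (p ^ kappa) k)))%:R) :> R].
Proof.
have q1 : (1 < q)%N := ltnW hq.
have nu1 : (1 < nu)%N := leq_trans hk hknu.
have P1 : (1 < p ^ kappa)%N := leq_trans q1 hqp.
split=> [q_pp|_||].
- by apply/eqP; rewrite eqn_leq hqp hmin.
- have [m m_pp /andP[qm m2q]] := prime_power_below_double q1.
  exact: leq_trans (hmin m m_pp qm) m2q.
- have [F _ cardF] := pPrimePowerField hp hkappa.
  have m0 : (0 < up_log (p ^ kappa) nu)%N by rewrite up_log_gt0 P1.
  have [T [u [cardT uOA]]] := bch_orthogonal_array F hk m0.
  have [|c c_inj] := @strong_coloring_map R k q I T.
    by rewrite -hnu cardT cardF up_logP.
  apply: le_trans (orthogonal_array_ratio _ _ hI uOA c_inj).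
  + rewrite card_mx muln1 cardF !div1r -invfM -natrM.
    by rewrite expnD expn1 (mulnC (k - _)%N) -mulnA expnM.
  + by rewrite q1 cardF.
  + by rewrite card_mx expn_gt0 cardF (ltnW P1).
- rewrite !div1r ler_wpM2l ?invr_ge0 // lef_pV2 ?posrE ?ltr0n.
  + rewrite ler_nat [in leqLHS]expnM [in leqLHS]expnM.
    case: (posnP (k - up_log (p ^ kappa) k)) => [-> // | r0].
    by rewrite leq_exp2r // up_log_pow_le.
  + by rewrite expn_gt0 muln_gt0 (ltnW P1) (ltnW nu1).
  + by rewrite expn_gt0 prime_gt0.
Qed.
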